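(* Let $n$ be a positive integer. Then $\mathrm{Dyer}(\widetilde S_n)$, the extended weak order of the affine symmetric group, is completely semidistributive.
   Context: Positive root system of $\widetilde S_n$: let $V$ be the real vector space with basis $\widetilde e_1,\dots,\widetilde e_n,\delta$, and put $\widetilde e_{i+kn}=\widetilde e_i+k\delta$ for $1\le i\le n$, $k\in\mathbb{Z}$, and $\widetilde\alpha_{a,b}=\widetilde e_b-\widetilde e_a$. Then $\Phi^+=\{\widetilde\alpha_{a,b}\mid a<b,\ a\not\equiv b \bmod n\}\subseteq V$. A subset $X\subseteq\Phi^+$ is closed if whenever $\alpha,\beta\in X$, $\gamma\in\Phi^+$ and $\gamma\in\mathbb{R}_{\ge0}\alpha+\mathbb{R}_{\ge0}\beta$, then $\gamma\in X$; it is biclosed if both $X$ and $\Phi^+\setminus X$ are closed. $\mathrm{Dyer}(\widetilde S_n)$ is the poset of biclosed subsets of $\Phi^+$ ordered by containment; it is known to be a complete lattice. A complete lattice $L$ is completely semidistributive if for all $y,z\in L$ and every nonempty (possibly infinite) $X\subseteq L$: if $x\vee y=z$ for all $x\in X$ then $(\bigwedge X)\vee y=z$; and if $x\wedge y=z$ for all $x\in X$ then $(\bigvee X)\wedge y=z$. *)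

(* Defs.v *)
From HB Require Import structures.
From mathcomp Require Import all_boot all_order all_algebra.
From mathcomp Require Import boolp classical_sets reals.

Set Implicit Arguments.
Unset Strict Implicit.
Unset Printing Implicit Defensive.

Import Order.TTheory GRing.Theory Num.Theory.
Local Open Scope classical_set_scope.
Local Open Scope ring_scope.

Definition complete_lattice (d : Order.disp_t) (L : porderType d) : Prop :=
  forall A : set L, supremums A !=set0 /\ infimums A !=set0.

(* [supremums A] and [infimums A] have at most one element, so quantifying over
   all their elements is quantifying over the join or meet of [A]. *)
Definition completely_semidistributive (d : Order.disp_t) (L : porderType d) :
    Prop :=
  complete_lattice L /\
  forall (y z : L) (X : set L), X !=set0 ->
    ((forall x, X x -> supremums [set x; y] z) ->
       forall m, infimums X m -> supremums [set m; y] z) /\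
    ((forall x, X x -> infimums [set x; y] z) ->
       forall m, supremums X m -> infimums [set m; y] z).

Section AffineRoots.
Variables (R : realType) (n : nat).

Local Notation rootspace := 'rV[R]_(n + 1).

(* The ordinal [i : 'I_n] stands for the index i + 1 in {1, ..., n}. *)
Definition ebase (i : 'I_n) : rootspace := delta_mx 0 (lshift 1 i).
Definition delta : rootspace := delta_mx 0 (rshift n ord0).

(* The sum has a single term: the i with a = (i + 1) + k n for some k. *)
Definition etilde (a : int) : rootspace :=
  \sum_(i < n | (a == i.+1%:Z %[mod n%:Z])%Z)
    (ebase i + (((a - i.+1%:Z) %/ n%:Z)%Z)%:~R *: delta).

Lemma etildeE (i : 'I_n) (k : int) :
  etilde (i.+1%:Z + k * n%:Z) = ebase i + k%:~R *: delta.
Proof.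
have n_gt0 : (0 < n)%N by apply: leq_ltn_trans (ltn_ord i).
have nz : n%:Z != 0 by rewrite eqz_nat -lt0n.
rewrite /etilde (big_pred1 i) => [|j].
  by rewrite addrAC subrr add0r mulzK.
rewrite addrC modzMDl -[i.+1]addn1 -[j.+1]addn1 !PoszD eqz_modDr.
by rewrite !modz_small ?lez_nat ?ltz_nat ?ltn_ord // eqz_nat eq_sym.
Qed.

Definition alpha (a b : int) : rootspace := etilde b - etilde a.

Definition pos_roots : set rootspace :=
  [set v | exists a b : int,
     [/\ a < b, (a != b %[mod n%:Z])%Z & v = alpha a b]].

Definition closed_roots (X : set rootspace) : Prop :=
  forall u v w : rootspace, X u -> X v -> pos_roots w ->
    (exists s t : R, [/\ 0 <= s, 0 <= t & w = s *: u + t *: v]) -> X w.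

Definition biclosed (X : set rootspace) : Prop :=
  [/\ X `<=` pos_roots, closed_roots X & closed_roots (pos_roots `\` X)].

Record dyer : Type :=
  Dyer { dyer_roots :> set rootspace; _ : `[< biclosed dyer_roots >] }.

HB.instance Definition _ := [isSub for dyer_roots].
HB.instance Definition _ := [Choice of dyer by <:].
(* The order inherited from [set rootspace], that is, inclusion. *)
HB.instance Definition _ := [SubChoice_isSubPOrder of dyer by <: with set_display].

Lemma dyer_leE (X Y : dyer) :
  (X <= Y)%O <-> (X : set rootspace) `<=` (Y : set rootspace).
Proof. by rewrite -subsetEset -leEsub. Qed.

End AffineRoots.

(* Main.v *)
Require Import Defs.
From mathcomp Require Import all_boot all_order all_algebra.
From mathcomp Require Import boolp classical_sets reals.
From mathcomp Require Import zify ring lra.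
From Stdlib Require Import Operators_Properties Relation_Operators.

(** A biclosed set is the real part of the inversion set of a translation
    invariant total order on the integers; such an inversion set is a
    translation invariant transitive and cotransitive relation on the pairs
    [a < b], the imaginary pairs [a = b mod n] included ([tito] below).  These
    relations form a complete lattice whose joins are transitive closures of
    unions, and complete semidistributivity holds there by induction on
    [b - a].  Every biclosed set [X] has a least lift to a [tito] and, dually, a
    greatest one; the two liftings are the left and right adjoints of taking
    real parts, which transports the result to biclosed sets. *)

Set Implicit Arguments.
Unset Strict Implicit.
Unset Printing Implicit Defensive.

Import Order.TTheory GRing.Theory Num.Theory.
Local Open Scope ring_scope.

(** * Translation invariant inversion relations on the integers *)

Section InversionRelations.
Variable n : nat.
Hypothesis n_gt0 : (0 < n)%N.
Local Notation irel := (int -> int -> Prop).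
Implicit Types (P Q : irel) (F : irel -> Prop) (a b c k : int).

Definition rsub P Q := forall a b, P a b -> Q a b.

Definition cong a b := (a == b %[mod n%:Z])%Z.

Lemma congP a b : reflect (exists k, b = a + k * n%:Z) (cong a b).
Proof.
rewrite /cong eq_sym eqz_mod_dvd; apply: (iffP dvdzP) => -[k hk]; exists k; lia.
Qed.

Lemma cong_shift a k : cong a (a + k * n%:Z).
Proof. by apply/congP; exists k. Qed.

Lemma cong_refl a : cong a a.
Proof. exact: eqxx. Qed.

Lemma cong_sym a b : cong a b = cong b a.
Proof. exact: eq_sym. Qed.

Lemma cong_unbounded a b : exists k, b < a + k * n%:Z.
Proof. by exists (`|b - a| + 1); nia. Qed.

Lemma congDl a b k : cong (a + k * n%:Z) b = cong a b.
Proof. by rewrite /cong addrC modzMDl. Qed.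

Lemma congDr a b k : cong a (b + k * n%:Z) = cong a b.
Proof. by rewrite cong_sym congDl cong_sym. Qed.

Lemma cong_trans a b c : cong a b -> cong b c = cong a c.
Proof. by move=> /eqP h; rewrite /cong h. Qed.

Lemma cong_gt0 a b : a < b -> cong a b -> exists2 k, 0 < k & b = a + k * n%:Z.
Proof. by move=> ab /congP [k hk]; exists k => //; nia. Qed.

Record tito P : Prop := Tito {
  tito_lt : forall a b, P a b -> a < b;
  tito_shift : forall k a b, P a b -> P (a + k * n%:Z) (b + k * n%:Z);
  tito_trans : forall a b c, P a b -> P b c -> P a c;
  tito_cotrans : forall a b c, a < b -> b < c -> P a c -> P a b \/ P b c }.

Definition dual P : irel := fun a b => a < b /\ ~ P a b.

Lemma unshift P :
  (forall k a b, P a b -> P (a + k * n%:Z) (b + k * n%:Z)) ->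
  forall k a b, P (a + k * n%:Z) (b + k * n%:Z) -> P a b.
Proof. by move=> sh k a b /(sh (- k)); rewrite !mulNr !addrK. Qed.

(** Complementation exchanges transitivity with cotransitivity; on total orders it is reversal. *)
Lemma tito_dual P : tito P -> tito (dual P).
Proof.
move=> [lt sh tr ct]; split.
- by move=> a b [].
- by move=> k a b [ab nP]; split; [lia | move=> /(unshift sh)].
- move=> a b c [ab nab] [bc nbc]; split; first exact: lt_trans bc.
  by move=> /(ct _ _ _ ab bc) [].
- move=> a b c ab bc [ac nac].
  have [Pab|] := EM (P a b); last by left.
  by right; split=> // Pbc; apply: nac; apply: tr Pbc.
Qed.

(** The pair [(a, a + n)] decides for its whole class: if it is missing, cotransitivity and
    translation exclude every longer imaginary pair; if it is present, transitivity and translation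
    produce them all. *)
Lemma tito_imag P a b j k : tito P -> P a (a + k * n%:Z) -> cong a b ->
  0 < j -> P b (b + j * n%:Z).
Proof.
move=> [lt sh tr ct] Pa /congP [l ->] j_gt0.
have k_gt0 : 0 < k by have := lt _ _ Pa; nia.
have P1 : P a (a + n%:Z).
  have [//|nP] := EM (P a (a + n%:Z)).
  have nPk m : ~ P a (a + m.+1%:Z * n%:Z).
    elim: m => [|m IH]; first by rewrite mul1r.
    move=> /(ct _ (a + m.+1%:Z * n%:Z)) [||//|]; try nia.
    rewrite (_ : a + m.+2%:Z * n%:Z = a + n%:Z + m.+1%:Z * n%:Z); last by lia.
    by move=> /(unshift sh).
  by case: k Pa k_gt0 => [[|m]|m] // Pa _; case: (nPk m).
rewrite addrAC; apply: (sh).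
case: j j_gt0 => [[|m]|m] // _.
elim: m => [|m IH]; first by rewrite mul1r.
apply: tr IH _; rewrite (_ : a + m.+2%:Z * n%:Z = a + n%:Z + m.+1%:Z * n%:Z).
  exact: sh.
by lia.
Qed.

(** * Joins and complete semidistributivity of inversion relations *)

Definition union_rel F : irel := fun a b => exists2 P, F P & P a b.

(** Chains are built from the left, so that induction removes their first step. *)
Definition tjoin F : irel := clos_trans_1n int (union_rel F).

Lemma tjoin_sub F Q : tito Q -> (forall P, F P -> rsub P Q) -> rsub (tjoin F) Q.
Proof.
move=> tQ FQ a b; elim=> {a b} [a b [P FP Pab]|a b c [P FP Pab] _ Qbc].
  exact: FQ FP _ _ Pab.
exact: tito_trans tQ _ _ _ (FQ _ FP _ _ Pab) Qbc.
Qed.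

(** For cotransitivity, a point between the ends of a chain is a vertex of it or falls strictly
    inside one step, which is then split by the cotransitivity of the relation providing that
    step. *)
Lemma tito_tjoin F : (forall P, F P -> tito P) -> tito (tjoin F).
Proof.
move=> tF; have lt a b : tjoin F a b -> a < b.
  elim=> {a b} [a b [P /tF tP /(tito_lt tP)]//|a b c [P /tF tP /(tito_lt tP)]].
  by move=> ab _; exact: lt_trans.
split=> //.
- move=> k a b; elim=> {a b} [a b [P FP Pab]|a b c [P FP Pab] _ IH].
    by apply: t1n_step; exists P => //; exact: tito_shift (tF _ FP) _ _ _ Pab.
  by apply: t1n_trans IH; exists P => //; exact: tito_shift (tF _ FP) _ _ _ Pab.
- move=> a b c ab bc; apply: clos_trans_t1n.
  exact: t_trans (clos_t1n_trans _ _ _ _ ab) (clos_t1n_trans _ _ _ _ bc).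
- move=> a b c ab bc Pac; elim: Pac b ab bc => {a c} [a c [P FP Pac] b ab bc|].
    case: (tito_cotrans (tF _ FP) ab bc Pac) => ?; [left|right];
      by apply: t1n_step; exists P.
  move=> a d c [P FP Pad] Pdc IH b ab bc.
  have Uad : union_rel F a d by exists P.
  case: (ltgtP b d) => [bd|db|->]; last by left; apply: t1n_step.
    case: (tito_cotrans (tF _ FP) ab bd Pad) => [Pab|Pbd].
      by left; apply: t1n_step; exists P.
    by right; apply: t1n_trans Pdc; exists P.
  case: (IH b db bc) => [Pdb|]; last by right.
  by left; apply: t1n_trans Pdb.
Qed.

(* A shortest pair (a, b) of [z] outside [w] cannot be split inside [z], so it
   lies in every [x] of [F].  Being outside the meet of [F], it is joined by a
   chain of pairs each missed by some [x]; along the chain there is a first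
   element [d] with [z a d], and the step [c -> d] reaching it gives
   [~ x a c], [~ x c d], [~ x d b] for one [x], against [x a b]. *)
Lemma tito_semidistr F (y z w : irel) :
  (forall x, F x -> tito x) -> tito y -> tito z -> tito w ->
  (forall x, F x -> rsub x z) -> rsub y z -> rsub y w ->
  (forall x v, F x -> tito v -> rsub x v -> rsub y v -> rsub z v) ->
  (forall v, tito v -> (forall x, F x -> rsub v x) -> rsub v w) ->
  rsub z w.
Proof.
move=> tF ty tz tw xz yz yw zj mw.
suff H N a b : (`|b - a| < N)%N -> z a b -> w a b.
  by move=> a b; apply: (H `|b - a|.+1).
elim: N a b => [//|N IH] a b abN zab.
have [//|nwab] := EM (w a b).
have ab := tito_lt tz zab.
have xab x : F x -> x a b.
  move=> Fx; pose G P := P = x \/ P = y.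
  have tG P : G P -> tito P by case=> ->; [exact: tF|].
  have Gz : rsub (tjoin G) z.
    by apply: tjoin_sub => // P [] ->; [exact: xz|].
  have : tjoin G a b.
    apply: (zj x) zab => //; first exact: tito_tjoin.
      by move=> c d xcd; apply: t1n_step; exists x => //; left.
    by move=> c d ycd; apply: t1n_step; exists y => //; right.
  move=> Gab.
  case: Gab abN zab nwab ab => [d [P GP Pad] _ _ nwad _|].
    by case: GP Pad => -> // /yw.
  move=> c d [P GP Pac] cb abN zab nwab ab.
  have zac : z a c by apply: Gz; apply: t1n_step; exists P.
  have zcb := Gz _ _ cb.
  have ac := tito_lt tz zac; have {}cb := tito_lt tz zcb.
  case: nwab; apply: (tito_trans tw (b := c)); apply: IH => //; lia.
pose D P := exists2 x, F x & P = dual x.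
have tD P : D P -> tito P by move=> [x /tF tx ->]; exact: tito_dual.
have chain : tjoin D a b.
  have [//|nDab] := EM (tjoin D a b).
  case: nwab; apply: (mw (dual (tjoin D))) => //.
    by apply: tito_dual; exact: tito_tjoin.
  move=> x Fx c d [cd nDcd].
  have [//|nxcd] := EM (x c d).
  by case: nDcd; apply: t1n_step; exists (dual x) => //; exists x.
suff H c e : tjoin D c e -> e = b -> a <= c -> a = c \/ ~ z a c -> False.
  by case: (H a b) => //; left.
elim=> {c e} [c d|c d e] [_ [x Fx ->] [cd nxcd]].
  move=> eqd ac upc; rewrite {d}eqd in cd nxcd *.
  case: upc => [eqc|nzac]; first by case: nxcd; rewrite -eqc; exact: xab.
  move: ac; rewrite le_eqVlt => /orP [/eqP eqc|ac].
    by case: nxcd; rewrite -eqc; exact: xab.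
  by case: (tito_cotrans (tF _ Fx) ac cd (xab _ Fx)) => // /(xz _ Fx).
move=> de IHd eqe ac upc; rewrite {e}eqe in de IHd.
have db := tito_lt (tito_tjoin tD) de.
have [zad|nzad] := EM (z a d); last first.
  by apply: IHd => //; [exact: ltW (le_lt_trans ac cd) | right].
have wad : w a d by apply: IH => //; lia.
have nxdb : ~ x d b.
  move=> xdb; apply: nwab; apply: (tito_trans tw wad); apply: IH; first by lia.
  exact: xz xdb.
have ad := le_lt_trans ac cd.
case: (tito_cotrans (tF _ Fx) ad db (xab _ Fx)) => // xad.
case: upc => [eqc|nzac]; first by apply: nxcd; rewrite -eqc.
move: ac; rewrite le_eqVlt => /orP [/eqP eqc|ac].
  by apply: nxcd; rewrite -eqc.
by case: (tito_cotrans (tF _ Fx) ac cd xad) => // /(xz _ Fx).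
Qed.

(** * Closed sets of real roots and their least lifts *)

(* [rc_conv] and [rc_imag] are what closure under real cones, as opposed to sums,
   adds inside the rank two affine subsystem of two classes modulo [n]. *)
Record rclosed P : Prop := RClosed {
  rc_lt : forall a b, P a b -> a < b;
  rc_real : forall a b, P a b -> ~~ cong a b;
  rc_shift : forall k a b, P a b -> P (a + k * n%:Z) (b + k * n%:Z);
  rc_add : forall a b c, P a b -> P b c -> ~~ cong a c -> P a c;
  rc_conv : forall a b j k, 0 <= j -> j <= k ->
    P a b -> P a (b + k * n%:Z) -> P a (b + j * n%:Z);
  rc_imag : forall a b j k, 0 <= j ->
    P a b -> P b (a + k * n%:Z) -> P a (b + j * n%:Z) }.

Definition rcompl P : irel := fun a b => [/\ a < b, ~~ cong a b & ~ P a b].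

Definition real_part P : irel := fun a b => P a b /\ ~~ cong a b.

Lemma rclosed_real_part P : tito P -> rclosed (real_part P).
Proof.
move=> tP; have [lt sh tr ct] := tP; split.
- by move=> a b [/lt].
- by move=> a b [].
- move=> k a b [Pab nab]; split; first exact: sh.
  by rewrite congDl congDr.
- move=> a b c [Pab _] [Pbc _] nac; split=> //; exact: tr Pbc.
- move=> a b j k j_ge0 jk [Pab nab] [Pabk _]; split; last by rewrite congDr.
  (* Were this pair missing, cotransitivity would give the imaginary pair [(b + j n, b + k n)]; its
     whole class is then inverted, and [a] reaches [b + j n] through [b]. *)
  have [//|nPabj] := EM (P a (b + j * n%:Z)).
  have ab := lt _ _ Pab.
  have jk' : j < k.
    by rewrite lt_neqAle jk andbT; apply/eqP => e; rewrite e in nPabj.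
  have ajk : a < b + j * n%:Z < b + k * n%:Z by nia.
  have /andP [aj jb] := ajk.
  case: (ct _ _ _ aj jb Pabk) => // Pjk.
  case: (ltgtP 0 j) j_ge0 => // [j_gt0|e] _; last first.
    by move: nPabj; rewrite -e mul0r addr0.
  apply: tr Pab _; apply: (@tito_imag _ (b + j * n%:Z) _ _ (k - j)) => //.
    by have -> : b + j * n%:Z + (k - j) * n%:Z = b + k * n%:Z by lia.
  by rewrite cong_sym cong_shift.
- move=> a b j k j_ge0 [Pab nab] [Pbak _]; split; last by rewrite congDr.
  case: (ltgtP 0 j) j_ge0 => // [j_gt0|<-] _; last by rewrite mul0r addr0.
  apply: (tr _ _ _ Pab).
  apply: (@tito_imag _ b _ _ k) => //; last exact: cong_refl.
  by apply: tr Pbak _; exact: sh.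
Qed.

(* The class of [a] is traversed downwards: [a + n] precedes [a] in every order
   whose inversions include [P]. *)
Definition wane P a := exists c k, P a c /\ P c (a + k * n%:Z).

(** Imaginary pairs enter only where [P] and transitivity force them. *)
Definition lift P : irel :=
  fun a b => a < b /\ if cong a b then wane P a else P a b.

Section Closed.
Variables (P : irel) (cP : rclosed P).

Lemma rc_neq a b : P a b -> cong a b = false.
Proof. by move/(rc_real cP)/negbTE. Qed.

(** The two roots lie on opposite sides of the imaginary ray, so their cone contains that ray and
    both translates can be raised. *)
Lemma rc_far a c j k l : P a c -> P c (a + k * n%:Z) -> 0 <= j -> k <= l ->
  P a (c + j * n%:Z) /\ P c (a + l * n%:Z).
Proof.
move=> Pac Pca j_ge0 kl; split; first exact: rc_imag Pac Pca.
rewrite (_ : a + _ = a + k * n%:Z + (l - k) * n%:Z); last by lia.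
by apply: (rc_imag cP (k := k)) => //; [lia | exact: rc_shift].
Qed.

Lemma wane_shift a k : wane P a -> wane P (a + k * n%:Z).
Proof.
move=> [c [j [Pac Pca]]]; exists (c + k * n%:Z), j.
rewrite addrAC; split; exact: rc_shift.
Qed.

Lemma wane_cong a b : cong a b -> wane P a -> wane P b.
Proof. by move=> /congP [k ->]; exact: wane_shift. Qed.

(** Stands in for the path through [a + m n], whose first step is imaginary and so outside [P]. The
    detour over [d] reaches a far translate of [b], and [rc_conv] fills in the earlier ones. *)
Lemma wane_addl a b m : P a b -> wane P a -> 0 <= m -> P a (b + m * n%:Z).
Proof.
move=> Pab [d [j [Pad Pda]]] m_ge0.
(* If [d] and [b] are congruent, the detour would itself contain an imaginary step; [rc_imag]
   replaces it. *)
case: (boolP (cong d b)) => [/congP [i eb]|ndb].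
  apply: (rc_imag cP (k := j + i)) => //.
  by rewrite eb mulrDl addrA; exact: rc_shift.
(* At least [j], for the return from [d] to the class of [a], and at least [m], for the
   interpolation. *)
pose l := `|j| + m.
have [jl ml l_ge0] : [/\ j <= l, m <= l & 0 <= l] by rewrite /l; split; lia.
apply: (rc_conv cP (k := l)) => //.
have [_ Pdl] := rc_far Pad Pda l_ge0 jl.
apply: (rc_add cP Pad); last by rewrite congDr (rc_neq Pab).
apply: (rc_add cP Pdl); last by rewrite congDr.
exact: rc_shift.
Qed.

Lemma wane_addr a b m : P a b -> wane P b -> 0 <= m -> P a (b + m * n%:Z).
Proof.
move=> Pab [d [j [Pbd Pdb]]] m_ge0.
case: (boolP (cong a d)) => [/congP [i ed]|nad].
  by apply: (rc_imag cP (k := i)) => //; rewrite -ed.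
pose l := `|j| + m.
have [jl ml l_ge0] : [/\ j <= l, m <= l & 0 <= l] by rewrite /l; split; lia.
apply: (rc_conv cP (k := l)) => //.
have [_ Pdl] := rc_far Pbd Pdb l_ge0 jl.
apply: (rc_add cP _ Pdl); last by rewrite congDr (rc_neq Pab).
exact: rc_add Pbd _.
Qed.

(** The mixed cases are [wane_addl] and [wane_addr]; two real pairs with an imaginary composite are
    a witness of [wane]. *)
Lemma lift_trans a b c : lift P a b -> lift P b c -> lift P a c.
Proof.
move=> [ab Lab] [bc Lbc]; split; first exact: lt_trans bc.
case: (boolP (cong a b)) Lab => [cab Wa|nab Pab].
  rewrite -(cong_trans _ cab); case: (boolP (cong b c)) Lbc => [//|nbc Pbc].
  have [k k_gt0 eb] := cong_gt0 ab cab.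
  suff : P (a + k * n%:Z) (c + k * n%:Z) by move/(unshift (rc_shift cP)).
  by rewrite -eb; apply: wane_addl => //; [exact: wane_cong Wa | lia].
case: (boolP (cong b c)) Lbc => [cbc Wb|nbc Pbc].
  have [k k_gt0 ec] := cong_gt0 bc cbc.
  by rewrite ec congDr (negbTE nab); apply: wane_addr => //; lia.
case: (boolP (cong a c)) => [/congP [k ec]|nac]; last exact: rc_add Pbc nac.
by exists b, k; rewrite -ec.
Qed.

End Closed.

(** * Lifts of biclosed sets *)

Section Biclosed.
Variables (P : irel) (cP : rclosed P) (cQ : rclosed (rcompl P)).

(** At far translates [P] holds in both directions between the classes of [a] and [d], and its
    complement between those of [a] and [b]. A far pair from [b] to [d] in [P] continues to [a]; one
    outside [P] is preceded by a step from [a]. Either way some pair lies in both relations. *)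
Lemma wane_rcompl a : wane P a -> wane (rcompl P) a -> False.
Proof.
move=> [d [j [Pad Pda]]] [b [i [Qab Qba]]].
have [Qlt Plt] := (rc_lt cQ, rc_lt cP).
(* Large enough for both return translates and for [b < d + l n]. *)
pose l := `|i| + `|j| + `|b - d| + 1.
have [il jl l_ge0] : [/\ i <= l, j <= l & 0 <= l] by rewrite /l; split; lia.
have [Padl Pdal] := rc_far cP Pad Pda l_ge0 jl.
have [Qabl Qbal] := rc_far cQ Qab Qba l_ge0 il.
case: (boolP (cong b d)) => [/congP [m ed]|nbd].
  have [Pam _] := rc_far cP Pad Pda (normr_ge0 m) jl.
  have mm : 0 <= m + `|m| by lia.
  have [[_ _ nP] _] := rc_far cQ Qab Qba mm il.
  by case: nP; move: Pam; rewrite ed -addrA -mulrDl.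
have bd : b < d + l * n%:Z by rewrite /l; nia.
have [Pbd|nPbd] := EM (P b (d + l * n%:Z)).
  have ill : i <= l + l by rewrite -[i]addr0 lerD.
  have [_ [_ nab nP]] := rc_far cQ Qab Qba l_ge0 ill.
  rewrite congDr in nab; case: nP; rewrite mulrDl addrA.
  apply: (rc_add cP Pbd); last by rewrite !congDr.
  exact: rc_shift.
suff [] : rcompl P a (d + l * n%:Z) by [].
apply: (rc_add cQ Qab); last by rewrite congDr (rc_neq cP Pad).
by split=> //; rewrite congDr.
Qed.

(* Among the roots of one rank two subsystem, ordered by slope, [P] omits an
   early one and contains a later one: it is a final segment, and contains all
   the roots on the far side of the imaginary ray. *)
Lemma rcompl_far a b k j : 0 < k -> rcompl P a b -> P a (b + k * n%:Z) ->
  b < a + j * n%:Z -> P b (a + j * n%:Z).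
Proof.
move=> k_gt0 Qab Pabk baj.
have [//|nPba] := EM (P b (a + j * n%:Z)).
suff [] : rcompl P a (b + k * n%:Z) by [].
apply: (rc_imag cQ (k := j)) => //; first exact: ltW.
by split=> //; rewrite congDr cong_sym; case: Qab.
Qed.

Lemma lift_cotrans a b c : a < b -> b < c -> lift P a c ->
  lift P a b \/ lift P b c.
Proof.
move=> ab bc [ac Lac].
case: (boolP (cong a b)) => [cab|nab].
  case: (boolP (cong b c)) => [cbc|nbc].
    by left; split=> //; move: Lac; rewrite -(cong_trans _ cab) cbc cab.
  have nac : ~~ cong a c by rewrite -(cong_trans _ cab).
  rewrite (negbTE nac) in Lac.
  have [Pbc|nPbc] := EM (P b c).
    by right; split=> //; rewrite (negbTE nbc).
  left; split=> //; rewrite cab.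
  have [k k_gt0 eb] := cong_gt0 ab cab.
  (* The pair [(a, c0)] is a translate of [(b, c)], hence outside [P], while [(a, c)] is in [P];
     [rcompl_far] gives the way back that makes [a] wane. *)
  pose c0 := c - k * n%:Z; have ec : c = c0 + k * n%:Z by rewrite /c0; lia.
  have Qac0 : rcompl P a c0.
    split; [by rewrite /c0; lia | by move: nac; rewrite ec congDr |].
    by move/(rc_shift cP k); rewrite -ec -eb.
  have [j c0j] := cong_unbounded a c0.
  exists c, (j + k); split=> //; rewrite mulrDl addrA ec; apply: rc_shift => //.
  by apply: (rcompl_far k_gt0 Qac0 _ c0j); rewrite -ec.
case: (boolP (cong b c)) => [cbc|nbc].
  have nac : ~~ cong a c by rewrite cong_sym (cong_trans _ cbc) cong_sym.
  rewrite (negbTE nac) in Lac.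
  have [Pab|nPab] := EM (P a b).
    by left; split=> //; rewrite (negbTE nab).
  right; split=> //; rewrite cbc.
  have [k k_gt0 ec] := cong_gt0 bc cbc; rewrite ec in Lac.
  have [j bj] := cong_unbounded a b.
  exists (a + j * n%:Z), (k + j); split.
    by apply: (rcompl_far k_gt0 _ Lac bj).
  by rewrite mulrDl addrA; exact: (rc_shift cP j Lac).
have [Pab|nPab] := EM (P a b); first by left; split=> //; rewrite (negbTE nab).
have [Pbc|nPbc] := EM (P b c); first by right; split=> //; rewrite (negbTE nbc).
have Qab : rcompl P a b by [].
have Qbc : rcompl P b c by [].
(* An imaginary [(a, c)] would make the class of [a] wane for [P] and, through [b], for the
   complement. *)
case: (boolP (cong a c)) Lac => [/congP [k ec] Wa|nac Pac].
  by case: (wane_rcompl Wa); exists b, k; rewrite -ec.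
by have [] := rc_add cQ Qab Qbc nac.
Qed.

Lemma tito_lift : tito (lift P).
Proof.
split; [by move=> a b [] | | exact: lift_trans | exact: lift_cotrans].
move=> k a b [ab Lab]; split; first by lia.
rewrite congDl congDr; case: ifP Lab => _; first exact: wane_shift.
exact: rc_shift.
Qed.

End Biclosed.

Lemma real_part_lift P : rclosed P -> real_part (lift P) = P.
Proof.
move=> cP; apply/funext => a; apply/funext => b; apply/propext; split.
  by move=> [[ab +] /negbTE nab]; rewrite nab.
move=> Pab; split; last exact: (rc_real cP Pab).
by split; [exact: (rc_lt cP Pab) | rewrite (rc_neq cP Pab)].
Qed.

(** The left adjunction. An imaginary pair of [lift P] comes from two pairs of [P]; these compose in
    [Q], and [tito_imag] spreads the composite over the class. *)
Lemma lift_sub P Q : rclosed P -> tito Q -> rsub P Q <-> rsub (lift P) Q.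
Proof.
move=> cP tQ; split=> PQ a b; last first.
  by rewrite -{1}(real_part_lift cP) => -[/PQ].
move=> [ab]; case: ifP => [cab [c [k [/PQ Qac /PQ Qca]]]|_ /PQ //].
have [j j_gt0 ->] := cong_gt0 ab cab.
exact: tito_imag (tito_trans tQ Qac Qca) (cong_refl a) j_gt0.
Qed.

End InversionRelations.

(** * Coordinates of affine roots *)

Section Roots.
Variables (R : realType) (n : nat) (n_gt0 : (0 < n)%N).
Local Notation irel := (int -> int -> Prop).
Local Notation vec := 'rV[R]_(n + 1).
Local Notation alpha := (alpha R n).
Local Notation etilde := (etilde R n).
Local Notation delta := (delta R n).
Local Notation cong := (cong n).
Local Notation pos_roots := (@pos_roots R n).
Implicit Types (P Q : irel) (a b c k l m : int) (i j r : 'I_n) (s t : R).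

Lemma cong_rep a : exists i k, a = i.+1%:Z + k * n%:Z.
Proof.
have nz : n%:Z != 0 by rewrite eqz_nat -lt0n.
(* The residue is that of [a - 1], since the ordinal [i] stands for the index [i + 1]. *)
have lt0 : 0 <= ((a - 1) %% n)%Z by rewrite modz_ge0.
have ltn : (`|((a - 1) %% n)%Z| < n)%N.
  have : ((a - 1) %% n)%Z < n%:Z by rewrite ltz_pmod.
  by lia.
exists (Ordinal ltn), ((a - 1) %/ n)%Z => /=.
by have := divz_eq (a - 1) n%:Z; lia.
Qed.

(** The second entry is written relative to the translate [k] of the first, so that [alpha_shift]
    removes [k] from both. *)
Lemma pair_rep a b : exists i j k l,
  a = i.+1%:Z + k * n%:Z /\ b = j.+1%:Z + l * n%:Z + k * n%:Z.
Proof.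
have [i [k ->]] := cong_rep a; have [j [l ->]] := cong_rep b.
by exists i, j, k, (l - k); split=> //; lia.
Qed.

Lemma etilde_shift a k :
  etilde (a + k * n%:Z) = etilde a + k%:~R *: delta.
Proof.
have [i [l ->]] := cong_rep a.
by rewrite -addrA -mulrDl !etildeE -addrA -scalerDl intrD.
Qed.

Lemma alpha_shift k a b : alpha (a + k * n%:Z) (b + k * n%:Z) = alpha a b.
Proof. by rewrite /Defs.alpha !etilde_shift opprD addrACA subrr addr0. Qed.

Lemma alpha_shiftr k a b :
  alpha a (b + k * n%:Z) = alpha a b + k%:~R *: delta.
Proof. by rewrite /Defs.alpha etilde_shift addrAC. Qed.

Lemma alpha_add a b c : alpha a b + alpha b c = alpha a c.
Proof. by rewrite /Defs.alpha addrC addrA subrK. Qed.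

Lemma alpha_imag a k : alpha a (a + k * n%:Z) = k%:~R *: delta.
Proof. by rewrite alpha_shiftr /Defs.alpha subrr add0r. Qed.

Lemma alpha_coord i j k r :
  alpha i.+1%:Z (j.+1%:Z + k * n%:Z) 0 (lshift 1 r) = (j == r)%:R - (i == r)%:R.
Proof.
rewrite -[i.+1%:Z]addr0 -[X in _ + X](mul0r n%:Z) /Defs.alpha !etildeE !mxE /=.
by rewrite !eq_lshift eq_lrshift /= !mulr0 !addr0 ![r == _]eq_sym.
Qed.

Lemma alpha_coord_delta i j k :
  alpha i.+1%:Z (j.+1%:Z + k * n%:Z) 0 (rshift n ord0) = k%:~R.
Proof.
rewrite -[i.+1%:Z]addr0 -[X in _ + X](mul0r n%:Z) /Defs.alpha !etildeE !mxE /=.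
by rewrite !eq_rlshift eq_rshift /= mul0r mulr1 !add0r subr0.
Qed.

Lemma cong_ord i j k : cong i.+1%:Z (j.+1%:Z + k * n%:Z) = (i == j).
Proof.
rewrite congDr -[LHS]/(i.+1%:Z == j.+1%:Z %[mod n%:Z])%Z.
rewrite -[i.+1]addn1 -[j.+1]addn1 !PoszD eqz_modDr.
by rewrite !modz_small ?lez_nat ?ltz_nat ?ltn_ord.
Qed.

Lemma cong_ord0 i j : cong i.+1%:Z j.+1%:Z = (i == j).
Proof. by rewrite -(congDr _ _ _ 0) cong_ord. Qed.

Lemma comb_coord s t (u v : vec) x y :
  (s *: u + t *: v) x y = s * u x y + t * v x y.
Proof. by rewrite !mxE. Qed.

(** The cone problem modulo [delta], for roots of finite type A, solved by comparing coordinates.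
    The outcomes match the closure rules: one of the two given roots, equal roots ([rc_conv]),
    opposite roots ([rc_imag]), a sum ([rc_add]). *)
Lemma cone_classes (T : eqType) (A B C D G : T) s t :
  A != B -> C != D -> A != G -> 0 <= s -> 0 <= t ->
  (forall x, (G == x)%:R - (A == x)%:R =
    s * ((B == x)%:R - (A == x)%:R) + t * ((D == x)%:R - (C == x)%:R) :> R) ->
  [\/ G = B /\ s = 1 /\ t = 0,
      [/\ G = D, C = A, s = 0 & t = 1],
      [/\ G = B, C = A, D = B & s + t = 1] |
      [/\ G = B, C = B, D = A & s = 1 + t]] \/ [/\ G = D, C = B, s = 1 & t = 1].
Proof.
move=> nAB nCD nAG s0 t0 H.
have nBA : B != A by rewrite eq_sym.
have nDC : D != C by rewrite eq_sym.
have nGA : G != A by rewrite eq_sym.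
have E := (eqxx, negbTE nAB, negbTE nBA, negbTE nCD, negbTE nDC,
  negbTE nAG, negbTE nGA).
have [eG|nGB] := eqVneq G B.
  left; subst G; have [t_eq0|t_neq0] := eqVneq t 0.
    constructor 1; split=> //; split=> //.
    by have := H A; rewrite !E t_eq0 /=; lra.
  have {t0 t_neq0} t0 : 0 < t by rewrite lt_neqAle eq_sym t_neq0.
  have [eC|nCA] := eqVneq C A.
    subst C; have [eD|nDB] := eqVneq D B.
      by subst D; constructor 3; split=> //; have := H B; rewrite !E /=; lra.
    by have := H D; rewrite !E ![_ == D]eq_sym (negbTE nDB) /=; lra.
  have [eC|nCB] := eqVneq C B.
    subst C; have [eD|nDA] := eqVneq D A.
      by subst D; constructor 4; split=> //; have := H A; rewrite !E /=; lra.
    by have := H D; rewrite !E ![_ == D]eq_sym (negbTE nDA) /=; lra.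
  have := H C; rewrite !E ![_ == C]eq_sym (negbTE nCB) (negbTE nCA) /=; lra.
have nBG : B != G by rewrite eq_sym.
have [eD|nDG] := eqVneq D G; last first.
  have := H G; rewrite !E (negbTE nBG) (negbTE nDG) /=.
  have : 0 <= t * (C == G)%:R by rewrite mulr_ge0 // ler0n.
  by lra.
subst D; have t1 : t = 1 by have := H G; rewrite !E (negbTE nBG) /=; lra.
subst t; have [eC|nCA] := eqVneq C A.
  by subst C; left; constructor 2; split=> //; have := H A; rewrite !E /=; lra.
right; have [eC|nCB] := eqVneq C B; last first.
  by have := H C; rewrite !E ![_ == C]eq_sym (negbTE nCA) (negbTE nCB) /=;
     lra.
by subst C; split=> //; have := H B; rewrite !E /=; lra.
Qed.

(** * Dictionary between closed sets of roots and closed relations *)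

Definition rootset P : set vec :=
  [set v | exists a b, P a b /\ v = alpha a b]%classic.

Lemma rootset_sub P : rclosed n P -> (rootset P `<=` pos_roots)%classic.
Proof.
move=> cP v [a [b [Pab ->]]]; exists a, b; split=> //.
  exact: (rc_lt cP Pab).
exact: (rc_real cP Pab).
Qed.

(** The classes are settled by [cone_classes], the translate by the [delta] coordinate
    [m = s k + t l]. *)
Lemma rclosed_cone P (A B C D G : 'I_n) k l m s t :
  rclosed n P ->
  P A.+1%:Z (B.+1%:Z + k * n%:Z) -> P C.+1%:Z (D.+1%:Z + l * n%:Z) ->
  A != G -> 0 <= s -> 0 <= t ->
  alpha A.+1%:Z (G.+1%:Z + m * n%:Z) =
    s *: alpha A.+1%:Z (B.+1%:Z + k * n%:Z) +
    t *: alpha C.+1%:Z (D.+1%:Z + l * n%:Z) ->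
  P A.+1%:Z (G.+1%:Z + m * n%:Z).
Proof.
move=> cP Pu Pv nAG s0 t0 eq_w.
have nAB : A != B by have := rc_real cP Pu; rewrite cong_ord.
have nCD : C != D by have := rc_real cP Pv; rewrite cong_ord.
have Hd : m%:~R = s * k%:~R + t * l%:~R :> R.
  have := congr1 (fun v : vec => v 0 (rshift n ord0)) eq_w.
  by rewrite /= comb_coord !alpha_coord_delta.
have Hc r : (G == r)%:R - (A == r)%:R =
    s * ((B == r)%:R - (A == r)%:R) + t * ((D == r)%:R - (C == r)%:R) :> R.
  have := congr1 (fun v : vec => v 0 (lshift 1 r)) eq_w.
  by rewrite /= comb_coord !alpha_coord.
have [[]|] := cone_classes nAB nCD nAG s0 t0 Hc.
- move=> [-> [es et]]; suff -> : m = k by [].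
  apply/eqP; rewrite -(eqr_int R) Hd es et; apply/eqP; lra.
- move=> [-> eC es et]; rewrite -eC; suff -> : m = l by [].
  apply/eqP; rewrite -(eqr_int R) Hd es et; apply/eqP; lra.
- move=> [-> eC eD est]; subst C D.
  have es : s = 1 - t by lra.
  (* Here [m] is a convex combination of [k] and [l]; interpolation starts from the smaller one. *)
  have [kl|/ltW lk] := leP k l.
    have klR : k%:~R <= l%:~R :> R by rewrite ler_int.
    have km : k <= m by rewrite -(ler_int R) Hd es; nra.
    have ml : m <= l by rewrite -(ler_int R) Hd es; nra.
    have -> : B.+1%:Z + m * n%:Z = B.+1%:Z + k * n%:Z + (m - k) * n%:Z by lia.
    apply: (rc_conv cP (k := l - k)) => //; try lia.
    have -> // : B.+1%:Z + k * n%:Z + (l - k) * n%:Z = B.+1%:Z + l * n%:Z.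
    by lia.
  have lkR : l%:~R <= k%:~R :> R by rewrite ler_int.
  have lm : l <= m by rewrite -(ler_int R) Hd es; nra.
  have mk : m <= k by rewrite -(ler_int R) Hd es; nra.
  have -> : B.+1%:Z + m * n%:Z = B.+1%:Z + l * n%:Z + (m - l) * n%:Z by lia.
  apply: (rc_conv cP (k := k - l)) => //; try lia.
  by have -> : B.+1%:Z + l * n%:Z + (k - l) * n%:Z = B.+1%:Z + k * n%:Z by lia.
- move=> [-> eC eD est]; subst C D.
  have Pv' := rc_shift cP k Pv; rewrite -addrA -mulrDl in Pv'.
  (* The two opposite pairs compose to an imaginary pair of length [(l + k) n], so
     [m = k + t (l + k)] is at least [k]. *)
  have lk0 : 0 <= l + k by have := rc_lt cP Pu; have := rc_lt cP Pv'; nia.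
  have lkR : 0 <= l%:~R + k%:~R :> R by rewrite -intrD ler0z.
  have km : k <= m by rewrite -(ler_int R) Hd est; nra.
  have -> : B.+1%:Z + m * n%:Z = B.+1%:Z + k * n%:Z + (m - k) * n%:Z by lia.
  by apply: (rc_imag cP (k := l + k)) => //; lia.
move=> [eG eC es et]; subst G C.
have -> : m = l + k.
  by apply/eqP; rewrite -(eqr_int R) Hd es et intrD; apply/eqP; lra.
rewrite mulrDl addrA; apply: (rc_add cP Pu); first exact: rc_shift.
by rewrite -addrA -mulrDl cong_ord.
Qed.

Lemma rclosed_cone_left P a b c d e g s t :
  rclosed n P -> P a b -> P c d -> ~~ cong e g -> cong e a ->
  0 <= s -> 0 <= t ->
  alpha e g = s *: alpha a b + t *: alpha c d -> P e g.
Proof.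
move=> cP Pab Pcd neg cea s0 t0 eq_w.
have [A [B [ka [k [ea eb]]]]] := pair_rep a b.
have [C [D [kc [l [ec ed]]]]] := pair_rep c d.
have [E [G [ke [m [ee eg]]]]] := pair_rep e g.
subst a b c d e g.
move: cea neg eq_w; rewrite !congDl !congDr !cong_ord0.
move=> /eqP eEA nEG; subst E.
rewrite !alpha_shift => eq_w; apply: rc_shift => //.
have Pu := unshift (rc_shift cP) Pab; have Pv := unshift (rc_shift cP) Pcd.
exact: rclosed_cone cP Pu Pv nEG s0 t0 eq_w.
Qed.

Lemma rclosed_cone_shift P a b c d e g s t :
  rclosed n P -> P a b -> P c d -> ~~ cong e g -> 0 <= s -> 0 <= t ->
  alpha e g = s *: alpha a b + t *: alpha c d -> P e g.
Proof.
move=> cP Pab Pcd neg s0 t0 eq_w.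
case: (boolP (cong e a)) => [cea|nea].
  exact: rclosed_cone_left Pab Pcd neg cea s0 t0 eq_w.
case: (boolP (cong e c)) => [cec|nec].
  by apply: (rclosed_cone_left cP Pcd Pab neg cec t0 s0); rewrite eq_w addrC.
have [A [B [ka [k [ea eb]]]]] := pair_rep a b.
have [C [D [kc [l [ec ed]]]]] := pair_rep c d.
have [E [G [ke [m [ee eg]]]]] := pair_rep e g.
subst a b c d e g.
move: nea nec neg eq_w; rewrite !congDl !congDr !cong_ord0 !alpha_shift.
move=> nEA nEC nEG eq_w.
(* At the class of [e] the root has coordinate -1, whereas the combination is nonnegative there. *)
have := congr1 (fun v : vec => v 0 (lshift 1 E)) eq_w.
rewrite /= comb_coord !alpha_coord eqxx.
rewrite ![_ == E]eq_sym (negbTE nEA) (negbTE nEC) (negbTE nEG) /=.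
have : 0 <= s * (E == B)%:R by rewrite mulr_ge0 // ler0n.
have : 0 <= t * (E == D)%:R by rewrite mulr_ge0 // ler0n.
by lra.
Qed.

Lemma closed_rootset P : rclosed n P -> closed_roots (rootset P).
Proof.
move=> cP u v w [a [b [Pab ->]]] [c [d [Pcd ->]]] [e [g [eg neg ->]]].
move=> [s [t [s0 t0 eq_w]]]; exists e, g; split=> //.
exact: rclosed_cone_shift Pab Pcd neg s0 t0 eq_w.
Qed.

Definition rootrel (X : set vec) : irel :=
  fun a b => [/\ a < b, ~~ cong a b & X (alpha a b)].

Lemma rclosed_rootrel (X : set vec) : closed_roots X -> rclosed n (rootrel X).
Proof.
have posI a b : a < b -> ~~ cong a b -> pos_roots (alpha a b).
  by exists a, b.
move=> cX; split.
- by move=> a b [].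
- by move=> a b [].
- move=> k a b [ab nab Xab]; split; first by lia.
    by rewrite congDl congDr.
  by rewrite alpha_shift.
- move=> a b c [ab nab Xab] [bc nbc Xbc] nac.
  have ac := lt_trans ab bc; split=> //.
  apply: (cX _ _ _ Xab Xbc); first exact: posI.
  by exists 1, 1; split=> //; rewrite !scale1r alpha_add.
- move=> a b j k j0 jk [ab nab Xab] [abk nabk Xabk].
  have [k0|k0] := eqVneq k 0.
    have -> : j = 0 by lia.
    by rewrite mul0r addr0.
  have kR : k%:~R != 0 :> R by rewrite intr_eq0.
  have {k0} k0 : 0 < k by lia.
  have abj : a < b + j * n%:Z by nia.
  have nabj : ~~ cong a (b + j * n%:Z) by rewrite congDr.
  split=> //; apply: (cX _ _ _ Xab Xabk); first exact: posI.
  (* With [u = alpha a b], the root [u + j delta] is the point at [j / k] of the segment from [u] to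
     [u + k delta]. *)
  exists (1 - j%:~R / k%:~R), (j%:~R / k%:~R); split.
  + by rewrite subr_ge0 ler_pdivrMr ?ltr0z // mul1r ler_int.
  + by rewrite divr_ge0 // ler0z; lia.
  + rewrite !alpha_shiftr; move: (alpha a b) => u.
    rewrite scalerDr addrA -scalerDl subrK scale1r scalerA.
    by rewrite divfK.
- move=> a b j k j0 [ab nab Xab] [ba nba Xba].
  have k0 : 0 < k by nia.
  have kR : k%:~R != 0 :> R by rewrite intr_eq0; lia.
  have abj : a < b + j * n%:Z by nia.
  have nabj : ~~ cong a (b + j * n%:Z) by rewrite congDr.
  have jk0 : 0 <= j%:~R / k%:~R :> R by rewrite divr_ge0 // ler0z; lia.
  split=> //; apply: (cX _ _ _ Xab Xba); first exact: posI.
  (* The two roots add up to [k delta]; the fraction [j / k] of this sum supplies [j delta]. *)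
  exists (1 + j%:~R / k%:~R), (j%:~R / k%:~R); split=> //.
    by rewrite addr_ge0.
  rewrite scalerDl scale1r -addrA -scalerDr alpha_add alpha_imag scalerA.
  by rewrite divfK // alpha_shiftr.
Qed.

Lemma rootsetK P : rclosed n P -> rootrel (rootset P) = P.
Proof.
move=> cP; apply/funext => c; apply/funext => d; apply/propext; split.
  move=> [_ ncd [a [b [Pab e]]]].
  (* Equality of roots is a cone relation with coefficients 1 and 0, so [P] depends only on the root
     and not on the pair representing it. *)
  apply: (rclosed_cone_shift cP Pab Pab ncd ler01 (lexx 0)).
  by rewrite scale1r scale0r addr0.
move=> Pcd; split; last by exists c, d.
  exact: (rc_lt cP Pcd).
exact: (rc_real cP Pcd).
Qed.

Lemma rootrelK (X : set vec) : (X `<=` pos_roots)%classic ->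
  rootset (rootrel X) = X.
Proof.
move=> sX; apply/seteqP; split=> [v [a [b [[_ _ Xab] ->]]] //|v Xv].
have [a [b [ab nab e]]] := sX v Xv; exists a, b; split=> //; split=> //.
by rewrite -e.
Qed.

Lemma rootrel_compl (X : set vec) :
  rootrel (pos_roots `\` X)%classic = rcompl n (rootrel X).
Proof.
apply/funext => a; apply/funext => b; apply/propext; split.
  by move=> [ab nab [_ nXab]]; split=> // -[].
move=> [ab nab nXab]; split=> //; split; first by exists a, b.
by move=> Xab; apply: nXab.
Qed.

Lemma rootset_compl P : rclosed n P ->
  (pos_roots `\` rootset P)%classic = rootset (rcompl n P).
Proof.
by move=> cP; rewrite -[LHS]rootrelK ?rootrel_compl ?rootsetK.
Qed.

Lemma rcompl_real_part P : rcompl n (real_part n P) = real_part n (dual P).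
Proof.
apply/funext => a; apply/funext => b; apply/propext; split.
  by move=> [ab nab nP]; split=> //; split=> // Pab; apply: nP.
by move=> [[ab nP] nab]; split=> // -[].
Qed.

Lemma biclosed_rootset P : tito n P -> biclosed (rootset (real_part n P)).
Proof.
move=> tP; have cP := rclosed_real_part n_gt0 tP; split.
- exact: rootset_sub.
- exact: closed_rootset.
- rewrite rootset_compl // rcompl_real_part; apply: closed_rootset.
  by apply: rclosed_real_part => //; exact: tito_dual.
Qed.

(** * The two lifts of a biclosed set and their adjunctions *)

Definition dyer_of_tito P (tP : tito n P) : dyer R n :=
  Dyer (asboolT (biclosed_rootset tP)).

Local Notation dyer := (dyer R n).
Implicit Types (X Y : dyer).

Lemma dyer_biclosed X : biclosed X.
Proof. by case: X => X0 bX; apply/asboolP. Qed.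

Lemma biclosed_compl X : biclosed (pos_roots `\` X)%classic.
Proof.
have [sX cX cQ] := dyer_biclosed X; split=> //.
rewrite (_ : (pos_roots `\` (pos_roots `\` X))%classic = X) //.
apply/seteqP; split=> v; last by move=> Xv; split; [exact: sX | case].
by move=> [pv nXv]; apply: contrapT => Xv; apply: nXv.
Qed.

Definition dyer_compl X : dyer := Dyer (asboolT (biclosed_compl X)).

Definition lower_tito X : irel := lift n (rootrel X).

(** Contains every imaginary pair except those that the complement of [X] forces out. *)
Definition upper_tito X : irel := dual (lower_tito (dyer_compl X)).

Lemma rclosed_dyer X : rclosed n (rootrel X).
Proof. by have [_ ? _] := dyer_biclosed X; exact: rclosed_rootrel. Qed.

Lemma rclosed_dyer_compl X : rclosed n (rcompl n (rootrel X)).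
Proof. by rewrite -rootrel_compl; exact: (rclosed_dyer (dyer_compl X)). Qed.

Lemma tito_lower X : tito n (lower_tito X).
Proof.
exact: (tito_lift n_gt0 (rclosed_dyer X) (rclosed_dyer_compl X)).
Qed.

Lemma tito_upper X : tito n (upper_tito X).
Proof. exact: (tito_dual n_gt0 (tito_lower (dyer_compl X))). Qed.

Lemma dyer_le_rootrel X Y : (X <= Y)%O <-> rsub (rootrel X) (rootrel Y).
Proof.
rewrite dyer_leE; split=> [XY a b [ab nab Xab]|XY v Xv].
  by split=> //; exact: XY.
have [sX _ _] := dyer_biclosed X.
by have [a [b [ab nab e]]] := sX _ Xv; rewrite e in Xv *; case: (XY a b).
Qed.

Lemma dyer_compl_le X Y : (dyer_compl X <= dyer_compl Y)%O = (Y <= X)%O.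
Proof.
apply/idP/idP => /dyer_leE h; apply/dyer_leE => v.
  have [sY _ _] := dyer_biclosed Y.
  move=> Yv; apply: contrapT => nXv.
  by have [] : (dyer_compl Y : set vec) v by apply: h; split=> //; exact: sY.
by move=> [pv nXv]; split=> // /h.
Qed.

Lemma dyer_complK : involutive dyer_compl.
Proof.
move=> X; apply/eqP; rewrite eq_le; apply/andP.
have [sX _ _] := dyer_biclosed X; split; apply/dyer_leE => v.
  by move=> [pv nXv]; apply: contrapT => Xv; apply: nXv.
by move=> Xv; split; [exact: sX | case].
Qed.

Lemma lower_tito_le X P (tP : tito n P) :
  rsub (lower_tito X) P <-> (X <= dyer_of_tito tP)%O.
Proof.
rewrite dyer_le_rootrel rootsetK; last exact: rclosed_real_part.
rewrite -(lift_sub n_gt0 (rclosed_dyer X) tP); split=> XP a b Xab.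
  by split; [exact: XP | case: Xab].
by have [] := XP _ _ Xab.
Qed.

Lemma dyer_of_dual P (tP : tito n P) :
  dyer_compl (dyer_of_tito tP) = dyer_of_tito (tito_dual n_gt0 tP).
Proof.
apply/val_inj => /=; rewrite rootset_compl ?rcompl_real_part //.
exact: rclosed_real_part.
Qed.

(** The right adjunction follows from the left one by complementation. *)
Lemma upper_tito_ge X P (tP : tito n P) :
  rsub P (upper_tito X) <-> (dyer_of_tito tP <= X)%O.
Proof.
rewrite -dyer_compl_le dyer_of_dual.
rewrite -lower_tito_le; split=> H a b.
  move=> Lab; split=> [|/H [_]//]; exact: tito_lt (tito_lower _) _ _ Lab.
by move=> Pab; split=> [|/H [_]//]; exact: tito_lt tP _ _ Pab.
Qed.

Lemma lower_tito_mono X Y : (X <= Y)%O -> rsub (lower_tito X) (lower_tito Y).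
Proof.
move=> /dyer_le_rootrel XY.
apply/(lift_sub n_gt0 (rclosed_dyer X) (tito_lower Y)) => a b Xab.
rewrite -(real_part_lift (rclosed_dyer Y)) in XY.
by have [] := XY _ _ Xab.
Qed.

Lemma dyer_of_tito_mono P Q (tP : tito n P) (tQ : tito n Q) :
  rsub P Q -> (dyer_of_tito tP <= dyer_of_tito tQ)%O.
Proof.
move=> PQ; apply/dyer_leE => v [a [b [[Pab nab] e]]]; exists a, b.
by split=> //; split=> //; exact: PQ.
Qed.

Lemma dyer_of_lower X : dyer_of_tito (tito_lower X) = X.
Proof.
apply/val_inj; rewrite /= (real_part_lift (rclosed_dyer X)).
by have [sX _ _] := dyer_biclosed X; exact: rootrelK.
Qed.

Lemma dyer_of_upper X : dyer_of_tito (tito_upper X) = X.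
Proof.
rewrite (Prop_irrelevance (tito_upper X) (tito_dual n_gt0 (tito_lower _))).
by rewrite -dyer_of_dual dyer_of_lower dyer_complK.
Qed.

(** * Completeness and complete semidistributivity *)

Lemma dyer_supremum (A : set dyer) : (supremums A !=set0)%classic.
Proof.
pose F P := exists2 X, A X & P = lower_tito X.
have tF P : F P -> tito n P by move=> [X _ ->]; exact: tito_lower.
have tJ := tito_tjoin tF.
(* The join of the least lifts, sent back by taking real parts. *)
exists (dyer_of_tito tJ); split=> [X AX|Y ubY].
  apply/lower_tito_le => a b Xab; apply: t1n_step.
  by exists (lower_tito X) => //; exists X.
rewrite -[Y]dyer_of_lower; apply: dyer_of_tito_mono; apply: tjoin_sub.
  exact: tito_lower.
by move=> P [X AX ->]; apply: lower_tito_mono; exact: ubY.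
Qed.

Lemma supremums_compl (A : set dyer) X :
  supremums A (dyer_compl X) <-> infimums (dyer_compl @` A)%classic X.
Proof.
split=> [[ubX minX]|[lbX maxX]].
  split=> [_ [Y AY <-]|Y lbY].
    by rewrite -dyer_compl_le dyer_complK; exact: ubX.
  rewrite -dyer_compl_le; apply: minX => Z AZ.
  by rewrite -dyer_compl_le dyer_complK; apply: lbY; exists Z.
split=> [Y AY|Y ubY].
  by rewrite -dyer_compl_le dyer_complK; apply: lbX; exists Y.
rewrite -dyer_compl_le dyer_complK; apply: maxX => _ [Z AZ <-].
by rewrite dyer_compl_le; exact: ubY.
Qed.

Lemma infimums_compl (A : set dyer) X :
  infimums A (dyer_compl X) <-> supremums (dyer_compl @` A)%classic X.
Proof.
rewrite -[in X in _ <-> X](dyer_complK X) supremums_compl image_comp.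
rewrite (_ : dyer_compl \o dyer_compl = id) ?image_id //.
by apply/funext => Y; exact: dyer_complK.
Qed.

Lemma dyer_complete_lattice : complete_lattice dyer.
Proof.
move=> A; split; first exact: dyer_supremum.
have [X supX] := dyer_supremum (dyer_compl @` A)%classic.
by exists (dyer_compl X); apply/infimums_compl.
Qed.

Lemma dyer_semidistr_join (Y Z : dyer) (A : set dyer) :
  (forall X, A X -> supremums [set X; Y]%classic Z) ->
  (A !=set0)%classic ->
  forall M : dyer, infimums A M -> supremums [set M; Y]%classic Z.
Proof.
move=> supZ [X0 AX0] M [lbM maxM].
have YZ : (Y <= Z)%O by have [ub _] := supZ _ AX0; apply: ub; right.
have XZ X : A X -> (X <= Z)%O.
  by move=> AX; have [ub _] := supZ _ AX; apply: ub; left.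
split=> [_ [->|->] //|W ubW]; first exact: le_trans (lbM _ AX0) (XZ _ AX0).
have MW : (M <= W)%O by apply: ubW; left.
have YW : (Y <= W)%O by apply: ubW; right.
(* The least lifts of [Z], [Y] and the members of [A] are set against the greatest lift of [W], so
   that the two adjunctions translate the hypotheses on joins and on the meet. *)
rewrite -[W]dyer_of_upper; apply/lower_tito_le.
pose F P := exists2 X, A X & P = lower_tito X.
apply: (@tito_semidistr n n_gt0 F (lower_tito Y)).
- by move=> _ [X _ ->]; exact: tito_lower.
- exact: tito_lower.
- exact: tito_lower.
- exact: tito_upper.
- by move=> _ [X AX ->]; apply: lower_tito_mono; exact: XZ.
- exact: lower_tito_mono.
- by apply/(upper_tito_ge _ (tito_lower Y)); rewrite dyer_of_lower.
- move=> _ v [X AX ->] tv /(lower_tito_le _ tv) Xv /(lower_tito_le _ tv) Yv.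
  apply/(lower_tito_le _ tv); have [_ minZ] := supZ _ AX.
  by apply: minZ => _ [->|->].
(* A [tito] below all the least lifts has its real part below each member of [A], hence below [M]
   and [W]. *)
- move=> v tv vF; apply/(upper_tito_ge _ tv); apply: le_trans MW.
  apply: maxM => X AX; rewrite -[X]dyer_of_lower; apply: dyer_of_tito_mono.
  by apply: vF; exists X.
Qed.

End Roots.

Arguments dyer_compl {R n}.

Theorem corollary5p19 (R : realType) (n : nat) (hn : (0 < n)%N) :
  completely_semidistributive (dyer R n).
Proof.
split=> [|y z X X0]; first exact: dyer_complete_lattice.
split=> H m mX; first exact: dyer_semidistr_join mX.
(* The meet half is the join half for the complements, since complementation is an order reversing
   involution. *)
rewrite -(dyer_complK z); apply/infimums_compl.
rewrite image_setU !image_set1.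
apply: (dyer_semidistr_join hn (A := dyer_compl @` X)).
- move=> _ [x Xx <-]; have := H x Xx.
  rewrite -{1}(dyer_complK z) => /infimums_compl.
  by rewrite image_setU !image_set1.
- by have [x Xx] := X0; exists (dyer_compl x), x.
- apply/infimums_compl; rewrite image_comp.
  by rewrite (_ : dyer_compl \o dyer_compl = id) ?image_id //;
     apply/funext => x; exact: dyer_complK.
Qed.
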